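(* Let $\boldsymbol\xi_1,\dots,\boldsymbol\xi_N\in\mathbb R^d$ and let $n_1,\dots,n_K$ be positive integers with $n_1+\dots+n_K=N$. Then $$\min\mathcal R_{\mathrm{LP}}\ \le\ \min\mathcal R_{\mathrm{SDP}}\ \le\ \min\mathcal P,$$ where $\mathcal P$, $\mathcal R_{\mathrm{SDP}}$ and $\mathcal R_{\mathrm{LP}}$ are the mixed-integer linear program, the semidefinite program and the linear program defined in the context.
   Context: Let $\mathbf D\in\mathbb S^N$ be the matrix with entries $d_{ij}=\|\boldsymbol\xi_i-\boldsymbol\xi_j\|^2$ (Euclidean norm), $\mathbb S^N$ the symmetric $N\times N$ matrices, $\langle\mathbf A,\mathbf B\rangle=\mathrm{Tr}(\mathbf A\mathbf B)$, $\mathbf 1$ the all-ones vector, $\mathrm{diag}(\mathbf A)$ the vector of diagonal entries of $\mathbf A$. $\mathbf A\succeq\mathbf B$ means $\mathbf A-\mathbf B$ is positive semidefinite; $\mathbf A\ge\mathbf B$ and $\mathbf A\le\mathbf B$ are elementwise. Problem $\mathcal P$ (cardinality-constrained $K$-means clustering): minimize $\frac12\sum_{k=1}^K\frac1{n_k}\sum_{i,j=1}^N d_{ij}\eta_{ij}^k$ over $\pi_i^k\in\{0,1\}$, $\eta_{ij}^k\in\mathbb R_+$ ($i,j=1,\dots,N$, $k=1,\dots,K$) subject to $\sum_{i=1}^N\pi_i^k=n_k$ for all $k$, $\sum_{k=1}^K\pi_i^k=1$ for all $i$, and $\eta_{ij}^k\ge\pi_i^k+\pi_j^k-1$ for all $i,j,k$.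 For $n\in\mathbb N$, $\mathcal C_{\mathrm{SDP}}(n)$ is the set of all $(\boldsymbol x,\mathbf M)\in\mathbb R^N\times\mathbb S^N$ such that (i) $\mathbf 1^\top\boldsymbol x=2n-N$, $\mathbf M\mathbf 1=(2n-N)\boldsymbol x$, $\mathrm{diag}(\mathbf M)=\mathbf 1$; (ii) $\mathbf M\succeq\boldsymbol x\boldsymbol x^\top$; (iii) $\mathbf M+\mathbf 1\mathbf 1^\top+\boldsymbol x\mathbf 1^\top+\mathbf 1\boldsymbol x^\top\ge\mathbf 0$, $\mathbf M+\mathbf 1\mathbf 1^\top-\boldsymbol x\mathbf 1^\top-\mathbf 1\boldsymbol x^\top\ge\mathbf 0$, $\mathbf M-\mathbf 1\mathbf 1^\top+\boldsymbol x\mathbf 1^\top-\mathbf 1\boldsymbol x^\top\le\mathbf 0$, $\mathbf M-\mathbf 1\mathbf 1^\top-\boldsymbol x\mathbf 1^\top+\mathbf 1\boldsymbol x^\top\le\mathbf 0$. $\mathcal C_{\mathrm{LP}}(n)$ is defined by (i) and (iii) only. Problem $\mathcal R_{\mathrm{SDP}}$: minimize $\frac18\big\langle\mathbf D,\sum_{k=1}^K\frac1{n_k}(\mathbf M^k+\mathbf 1\mathbf 1^\top+\boldsymbol x^k\mathbf 1^\top+\mathbf 1(\boldsymbol x^k)^\top)\big\rangle$ subject to $(\boldsymbol x^k,\mathbf M^k)\in\mathcal C_{\mathrm{SDP}}(n_k)$ for $k=1,\dots,K$ and $\sum_{k=1}^K\boldsymbol x^k=(2-K)\mathbf 1$. Problem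 $\mathcal R_{\mathrm{LP}}$ is obtained from $\mathcal R_{\mathrm{SDP}}$ by replacing each $\mathcal C_{\mathrm{SDP}}(n_k)$ with $\mathcal C_{\mathrm{LP}}(n_k)$. *)

(* Defs.v *)
From mathcomp Require Import all_boot all_order all_algebra.
From mathcomp Require Import boolp classical_sets reals.

Set Implicit Arguments.
Unset Strict Implicit.
Unset Printing Implicit Defensive.

Import Order.TTheory GRing.Theory Num.Theory.
Local Open Scope classical_set_scope.
Local Open Scope ring_scope.

Definition is_min (R : realType) (A : set R) (m : R) : Prop :=
  A m /\ lbound A m.

Section Matrices.
Context {R : realType}.

(* Not the library norm `|u|, which on matrices is the sup norm. *)
Definition enorm d (u : 'cV[R]_d) : R := Num.sqrt (\sum_(l < d) u l 0 ^+ 2).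

Definition dist_mx d N (xi : 'I_N -> 'cV[R]_d) : 'M[R]_N :=
  \matrix_(i, j) enorm (xi i - xi j) ^+ 2.

Definition inner_mx N (A B : 'M[R]_N) : R := \tr (A *m B).

Definition ones N : 'cV[R]_N := const_mx 1.

Definition diag_vec N (A : 'M[R]_N) : 'cV[R]_N := \col_i A i i.

Definition psd N (A : 'M[R]_N) : Prop :=
  A^T = A /\ forall v : 'cV[R]_N, 0 <= (v^T *m A *m v) 0 0.

Definition loewner_ge N (A B : 'M[R]_N) : Prop := psd (A - B).

Definition le_elt N (A B : 'M[R]_N) : Prop := forall i j, A i j <= B i j.

End Matrices.

Arguments ones {R} N.

Section Clustering.
Context {R : realType} (N K : nat).

Definition milp_var : Type :=
  (('I_N -> 'I_K -> R) * ('I_N -> 'I_N -> 'I_K -> R))%type.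

Definition milp_feasible (n : 'I_K -> nat) : set milp_var :=
  [set p | let: (pi, eta) := p in
    [/\ (forall i k, pi i k = 0 \/ pi i k = 1),
        (forall i j k, 0 <= eta i j k),
        (forall k, \sum_(i < N) pi i k = (n k)%:R),
        (forall i, \sum_(k < K) pi i k = 1)
      & (forall i j k, pi i k + pi j k - 1 <= eta i j k)]].

Definition milp_obj (D : 'M[R]_N) (n : 'I_K -> nat) (p : milp_var) : R :=
  2^-1 * \sum_(k < K) (n k)%:R^-1 *
    \sum_(i < N) \sum_(j < N) D i j * p.2 i j k.

Definition milp_values (D : 'M[R]_N) (n : 'I_K -> nat) : set R :=
  milp_obj D n @` milp_feasible n.

(* 2n - N computed in R, as it may be negative *)
Definition card_offset (n : nat) : R := 2 * n%:R - N%:R.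

Definition C_linear (n : nat) : set ('cV[R]_N * 'M[R]_N) :=
  [set p | let: (x, M) := p in
    [/\ M^T = M,
        ((ones N)^T *m x) 0 0 = card_offset n,
        M *m ones N = card_offset n *: x
      & diag_vec M = ones N]].

Definition C_elementwise : set ('cV[R]_N * 'M[R]_N) :=
  [set p | let: (x, M) := p in
    let J := ones N *m (ones N)^T in
    let X := x *m (ones N)^T in
    let Y := ones N *m x^T in
    [/\ le_elt 0 (M + J + X + Y),
        le_elt 0 (M + J - X - Y),
        le_elt (M - J + X - Y) 0
      & le_elt (M - J - X + Y) 0]].

Definition C_LP (n : nat) : set ('cV[R]_N * 'M[R]_N) :=
  C_linear n `&` C_elementwise.

Definition C_SDP (n : nat) : set ('cV[R]_N * 'M[R]_N) :=
  [set p | [/\ C_linear n p, loewner_ge p.2 (p.1 *m p.1^T) & C_elementwise p]].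

Definition relax_var : Type := (('I_K -> 'cV[R]_N) * ('I_K -> 'M[R]_N))%type.

Definition relax_feasible (C : nat -> set ('cV[R]_N * 'M[R]_N))
    (n : 'I_K -> nat) : set relax_var :=
  [set p | let: (x, M) := p in
    (forall k, C (n k) (x k, M k)) /\
    \sum_(k < K) x k = (2 - K%:R) *: ones N].

Definition relax_obj (D : 'M[R]_N) (n : 'I_K -> nat) (p : relax_var) : R :=
  8^-1 * inner_mx D (\sum_(k < K) (n k)%:R^-1 *:
    (p.2 k + ones N *m (ones N)^T + p.1 k *m (ones N)^T + ones N *m (p.1 k)^T)).

Definition sdp_values (D : 'M[R]_N) (n : 'I_K -> nat) : set R :=
  relax_obj D n @` relax_feasible C_SDP n.

Definition lp_values (D : 'M[R]_N) (n : 'I_K -> nat) : set R :=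
  relax_obj D n @` relax_feasible C_LP n.

End Clustering.

(* Main.v *)
(* A feasible assignment pi of the mixed-integer program lifts to the vectors
   x^k = 2 pi^k - 1 with entries +-1 and the matrices M^k = x^k (x^k)^T, which
   are feasible for the semidefinite program. The objective is preserved when
   eta_ij^k = pi_i^k pi_j^k, the smallest admissible eta, which is optimal
   because distances are nonnegative. As for existence of the minima, the
   elementwise inequalities and diag M = 1 confine all entries of x and M to
   [-1, 1], so both relaxations minimize a continuous function over a nonempty
   compact set, and the mixed-integer program reduces to finitely many pi. *)

Require Import Defs.
From mathcomp Require Import all_boot all_order all_algebra.
From mathcomp Require Import boolp classical_sets reals.
From mathcomp Require Import topology normedtype derive ring lra.

Import Order.TTheory GRing.Theory Num.Theory.
Import numFieldNormedType.Exports.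
Local Open Scope ring_scope.

(** * Entrywise continuity of matrix maps and the closed conditions built from it *)

Section EntrywiseContinuity.
Local Open Scope classical_set_scope.
Context {R : realType} {T : topologicalType}.

(** Phrased through entries, so that continuity of one entry of a product, or of a trace, follows by
    application and no topology on matrices enters. *)
Definition mx_continuous {m n} (F : T -> 'M[R]_(m, n)) : Prop :=
  forall i j, continuous (fun t => F t i j).

Lemma mx_continuous_cst m n (A : 'M[R]_(m, n)) : mx_continuous (fun=> A).
Proof. by move=> i j; exact: cst_continuous. Qed.

Lemma mx_continuousD m n (F G : T -> 'M[R]_(m, n)) :
  mx_continuous F -> mx_continuous G ->
  mx_continuous (fun t => F t + G t).
Proof.
move=> cF cG i j; under eq_fun do rewrite mxE.
by move=> t; apply: cvgD; [exact: cF | exact: cG].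
Qed.

Lemma mx_continuousN m n (F : T -> 'M[R]_(m, n)) :
  mx_continuous F -> mx_continuous (fun t => - F t).
Proof.
move=> cF i j; under eq_fun do rewrite mxE.
by move=> t; apply: cvgN; exact: cF.
Qed.

Lemma mx_continuousZ m n (a : R) (F : T -> 'M[R]_(m, n)) :
  mx_continuous F -> mx_continuous (fun t => a *: F t).
Proof.
move=> cF i j; under eq_fun do rewrite mxE.
by move=> t; apply: cvgM; [exact: cvg_cst | exact: cF].
Qed.

Lemma mx_continuous_tr m n (F : T -> 'M[R]_(m, n)) :
  mx_continuous F -> mx_continuous (fun t => (F t)^T).
Proof. by move=> cF i j; under eq_fun do rewrite mxE; exact: cF. Qed.

Lemma continuous_bigsum (I : Type) (r : seq I) (F : I -> T -> R) :
  (forall i, continuous (F i)) ->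
  continuous (fun t => \sum_(i <- r) F i t).
Proof.
move=> cF; elim: r => [|i r IHr].
  by under eq_fun do rewrite big_nil; exact: cst_continuous.
under eq_fun do rewrite big_cons.
by move=> t; apply: cvgD; [exact: cF | exact: IHr].
Qed.

Lemma mx_continuousM m n p (F : T -> 'M[R]_(m, n)) (G : T -> 'M[R]_(n, p)) :
  mx_continuous F -> mx_continuous G ->
  mx_continuous (fun t => F t *m G t).
Proof.
move=> cF cG i j; under eq_fun do rewrite mxE.
apply: continuous_bigsum => k t.
by apply: cvgM; [exact: cF | exact: cG].
Qed.

Lemma mx_continuous_sum (I : Type) (r : seq I) m n
    (F : I -> T -> 'M[R]_(m, n)) :
  (forall k, mx_continuous (F k)) ->
  mx_continuous (fun t => \sum_(k <- r) F k t).
Proof.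
move=> cF i j; under eq_fun do rewrite summxE.
by apply: continuous_bigsum => k; exact: cF.
Qed.

Lemma closed_forall (I : Type) (P : I -> T -> Prop) :
  (forall i, closed [set t | P i t]) -> closed [set t | forall i, P i t].
Proof.
move=> cP; rewrite (_ : mkset _ = \bigcap_(i in setT) [set t | P i t]).
  by apply: closed_bigI => i _; exact: cP.
by apply/seteqP; split=> [t Pt i _ | t Pt i]; [exact: Pt | exact: Pt].
Qed.

Lemma closed_and (P Q : T -> Prop) :
  closed [set t | P t] -> closed [set t | Q t] ->
  closed [set t | P t /\ Q t].
Proof. exact: closedI. Qed.

Lemma closed_fun_ge0 (f : T -> R) : continuous f -> closed [set t | 0 <= f t].
Proof.
move=> cf; apply: (@preimage_closed _ _ f [set x | 0 <= x]).
  by move=> t _; exact: cf.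
exact: closed_ge.
Qed.

Lemma closed_fun_eq (f g : T -> R) :
  continuous f -> continuous g -> closed [set t | f t = g t].
Proof.
move=> cf cg.
rewrite (_ : mkset _ = (fun t => f t - g t) @^-1` [set x | x = 0]).
  apply: preimage_closed; last exact: closed_eq.
  by move=> t _; apply: cvgB; [exact: cf | exact: cg].
by apply/seteqP; split=> t /= => [->|/eqP]; rewrite ?subrr// subr_eq0 => /eqP.
Qed.

Lemma closed_mx_eq m n (F G : T -> 'M[R]_(m, n)) :
  mx_continuous F -> mx_continuous G -> closed [set t | F t = G t].
Proof.
move=> cF cG.
rewrite (_ : mkset _ = [set t | forall i j, F t i j = G t i j]).
  apply: closed_forall => i; apply: closed_forall => j.
  by apply: closed_fun_eq; [exact: cF | exact: cG].
by apply/seteqP; split=> t /= => [->//|H]; apply/matrixP.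
Qed.

Lemma closed_le_elt n (F G : T -> 'M[R]_n) :
  mx_continuous F -> mx_continuous G ->
  closed [set t | le_elt (F t) (G t)].
Proof.
move=> cF cG; apply: closed_forall => i; apply: closed_forall => j.
under eq_set do rewrite -subr_ge0.
by apply: closed_fun_ge0 => t; apply: cvgB; [exact: cG | exact: cF].
Qed.

(** For a fixed test vector the quadratic form is linear in the matrix, hence continuous in [t]; the
    sign conditions are then intersected over all test vectors. *)
Lemma closed_psd n (F : T -> 'M[R]_n) :
  mx_continuous F -> closed [set t | psd (F t)].
Proof.
move=> cF; apply: closed_and.
  by apply: closed_mx_eq => //; exact: mx_continuous_tr.
apply: closed_forall => v; apply: closed_fun_ge0.
apply: mx_continuousM; last exact: mx_continuous_cst.
by apply: mx_continuousM => //; exact: mx_continuous_cst.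
Qed.

End EntrywiseContinuity.

(** * Closedness of the constraint sets of the two relaxations *)

Section ClosedConstraints.
Local Open Scope classical_set_scope.
Context {R : realType} {T : topologicalType} {N : nat}.
Variables (x : T -> 'cV[R]_N) (M : T -> 'M[R]_N).
Hypotheses (cx : mx_continuous x) (cM : mx_continuous M).

Lemma closed_C_linear n : closed [set t | C_linear n (x t, M t)].
Proof.
rewrite (_ : mkset _ =
  [set t | ((M t)^T = M t /\ ((ones N)^T *m x t) 0 0 = card_offset N n) /\
           (M t *m ones N = card_offset N n *: x t /\
            diag_vec (M t) = ones N)]); last first.
  by apply/seteqP; split=> t /= => [[]|[[? ?] []]].
apply: closed_and; apply: closed_and.
- by apply: closed_mx_eq => //; exact: mx_continuous_tr.
- apply: closed_fun_eq; last exact: cst_continuous.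
  by apply: mx_continuousM => //; exact: mx_continuous_cst.
- apply: closed_mx_eq; last exact: mx_continuousZ.
  by apply: mx_continuousM => //; exact: mx_continuous_cst.
- apply: closed_mx_eq; last exact: mx_continuous_cst.
  by move=> i j; under eq_fun do rewrite mxE; exact: cM.
Qed.

Lemma closed_C_elementwise : closed [set t | C_elementwise (x t, M t)].
Proof.
pose J := ones N *m (ones N)^T : 'M[R]_N.
pose X t := x t *m (ones N)^T.
pose Y t := ones N *m (x t)^T.
have cJ : mx_continuous (fun _ : T => J) by exact: mx_continuous_cst.
have cX : mx_continuous X.
  by apply: mx_continuousM => //; exact: mx_continuous_cst.
have cY : mx_continuous Y.
  by apply: mx_continuousM; [exact: mx_continuous_cst|exact: mx_continuous_tr].
have c0 : mx_continuous (fun _ : T => 0 : 'M[R]_N).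
  exact: mx_continuous_cst.
rewrite (_ : mkset _ =
  [set t | (le_elt 0 (M t + J + X t + Y t) /\
            le_elt 0 (M t + J - X t - Y t)) /\
           (le_elt (M t - J + X t - Y t) 0 /\
            le_elt (M t - J - X t + Y t) 0)]); last first.
  by apply/seteqP; split=> t /= => [[]|[[? ?] []]].
by apply: closed_and; apply: closed_and; apply: closed_le_elt => //;
  do ?[apply: mx_continuousD => // | apply: mx_continuousN => //].
Qed.

Lemma closed_C_LP n : closed [set t | C_LP n (x t, M t)].
Proof.
by apply: closed_and; [exact: closed_C_linear | exact: closed_C_elementwise].
Qed.

Lemma closed_C_SDP n : closed [set t | C_SDP n (x t, M t)].
Proof.
rewrite (_ : mkset _ =
  [set t | C_linear n (x t, M t) /\
    (psd (M t - x t *m (x t)^T) /\ C_elementwise (x t, M t))]); last first.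
  by apply/seteqP; split=> t /= => [[]|[? []]].
apply: closed_and; first exact: closed_C_linear.
apply: closed_and; last exact: closed_C_elementwise.
apply: closed_psd; apply: mx_continuousD => //; apply: mx_continuousN.
by apply: mx_continuousM => //; exact: mx_continuous_tr.
Qed.

End ClosedConstraints.

(** * Compactness of the feasible sets and existence of the relaxation minima *)

Section Relaxation.
Local Open Scope classical_set_scope.
Context {R : realType} {N K : nat}.
Implicit Types (D : 'M[R]_N) (n : 'I_K -> nat).

(** Adding the first two inequalities gives [M i j >= -1], adding the last two gives [M i j <= 1].
    Where [M i i = 1], the first two read [2 + 2 x_i >= 0] and [2 - 2 x_i >= 0]. *)
Lemma C_elementwise_bound (x : 'cV[R]_N) (M : 'M[R]_N) :
  C_elementwise (x, M) ->
  (forall i j, -1 <= M i j <= 1) /\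
  ((forall i, M i i = 1) -> forall i, -1 <= x i 0 <= 1).
Proof.
move=> [h1 h2 h3 h4].
have e i j := (h1 i j, h2 i j, h3 i j, h4 i j).
have {}e i j : [/\ 0 <= M i j + 1 + x i 0 + x j 0,
    0 <= M i j + 1 - x i 0 - x j 0, M i j - 1 + x i 0 - x j 0 <= 0 &
    M i j - 1 - x i 0 + x j 0 <= 0].
  by case: (e i j) => [[[]]]; rewrite !mxE !big_ord1 !mxE !mul1r !mulr1.
split=> [i j|dM i]; first by case: (e i j) => ? ? ? ?; lra.
by case: (e i i); rewrite dM => ? ? ? ?; lra.
Qed.

(* A family ((x_k, M_k))_k is coded by a real function on triples (k, i, o):
   o = None gives x_k i and o = Some j gives M_k i j. *)
Definition coord : Type := ('I_K * 'I_N * option 'I_N)%type.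

Definition decode (t : coord -> R) : relax_var N K :=
  (fun k => \col_i t (k, i, None), fun k => \matrix_(i, j) t (k, i, Some j)).

Definition encode (p : relax_var N K) (c : coord) : R :=
  if c.2 is Some j then p.2 c.1.1 c.1.2 j else p.1 c.1.1 c.1.2 0.

(** Every family has a code, so minimizing over codes is minimizing over families. *)
Lemma encodeK : cancel encode decode.
Proof.
move=> [x M]; congr pair; apply/funext => k.
  by apply/colP => i; rewrite mxE.
by apply/matrixP => i j; rewrite mxE.
Qed.

(** The product topology makes each coordinate continuous and opens the way to Tychonoff's theorem
    for boxes. *)
Let T : topologicalType := prod_topology (fun _ : coord => R).

Lemma continuous_coord (c : coord) : continuous (fun t : T => t c).
Proof. exact: (@proj_continuous _ (fun _ : coord => R) c). Qed.

Lemma mx_continuous_decode1 k :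
  mx_continuous (fun t : T => (decode t).1 k).
Proof.
by move=> i j; under eq_fun do rewrite mxE; exact: continuous_coord.
Qed.

Lemma mx_continuous_decode2 k :
  mx_continuous (fun t : T => (decode t).2 k).
Proof.
by move=> i j; under eq_fun do rewrite mxE; exact: continuous_coord.
Qed.

Lemma continuous_relax_obj D n :
  continuous (fun t : T => relax_obj D n (decode t)).
Proof.
suff c : continuous (fun t : T => inner_mx D (\sum_(k < K) (n k)%:R^-1 *:
    ((decode t).2 k + ones N *m (ones N)^T + (decode t).1 k *m (ones N)^T +
     ones N *m ((decode t).1 k)^T))).
  by move=> t; apply: (cvgM (cvg_cst _) (c t)).
rewrite /inner_mx /mxtrace; apply: continuous_bigsum => i.
apply: mx_continuousM; first exact: mx_continuous_cst.
apply: mx_continuous_sum => k; apply: mx_continuousZ.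
apply: mx_continuousD; first apply: mx_continuousD.
- apply: mx_continuousD; last exact: mx_continuous_cst.
  exact: mx_continuous_decode2.
- by apply: mx_continuousM; [exact: mx_continuous_decode1
                            |exact: mx_continuous_cst].
- apply: mx_continuousM; first exact: mx_continuous_cst.
  by apply: mx_continuous_tr; exact: mx_continuous_decode1.
Qed.

(** Stated for any [C] inside [C_LP] to serve both relaxations: the inclusion gives boundedness, the
    second hypothesis closedness, and the extreme value theorem concludes. *)
Lemma relax_has_min (C : nat -> set ('cV[R]_N * 'M[R]_N)) D n :
  (forall m p, C m p -> C_LP m p) ->
  (forall m (x : T -> 'cV[R]_N) (M : T -> 'M[R]_N),
     mx_continuous x -> mx_continuous M ->
     closed [set t | C m (x t, M t)]) ->
  relax_feasible C n !=set0 ->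
  exists v, is_min (relax_obj D n @` relax_feasible C n) v.
Proof.
move=> CLP Ccl [p0 Cp0].
pose A : set T := decode @^-1` relax_feasible C n.
have A0 : A !=set0 by exists (encode p0); rewrite /A /preimage /mkset encodeK.
(* Entries of [M] are bounded outright, those of [x] through the unit diagonal [dM]. *)
have box : A `<=` [set t : T | forall c, `[-1, 1] (t c)].
  move=> t [/= Ct _] [[k i] o] /=; rewrite in_itv /=.
  have [[_ _ _ /colP dM] /C_elementwise_bound[bM bx]] := CLP _ _ (Ct k).
  case: o => [j|]; first by have := bM i j; rewrite mxE.
  have := bx _ i; rewrite mxE; apply => j.
  by have := dM j; rewrite !mxE.
have clA : closed A.
  apply: closed_and.
    apply: closed_forall => k; apply: Ccl.
      exact: mx_continuous_decode1.
    exact: mx_continuous_decode2.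
  apply: closed_mx_eq; last exact: mx_continuous_cst.
  by apply: mx_continuous_sum => k; exact: mx_continuous_decode1.
have cA : compact A.
  apply: subclosed_compact clA _ box.
  have cI (c : coord) : compact (`[-1, 1] : set R) by exact: segment_compact.
  exact (tychonoff cI).
have [t /set_mem At tmin] := compact_EVT_min A0 cA
  (continuous_subspaceT (continuous_relax_obj D n)).
exists (relax_obj D n (decode t)); split; first by exists (decode t).
move=> _ [p Cp <-]; rewrite -(encodeK p); apply: tmin.
by apply/mem_set; rewrite /A /preimage /mkset encodeK.
Qed.

End Relaxation.

(** * Lifting of integer assignments, and minima of the integer program *)

Section Lifting.
Local Open Scope classical_set_scope.
Context {R : realType} {N K : nat}.
Implicit Types (D : 'M[R]_N) (n : 'I_K -> nat) (pi : 'I_N -> 'I_K -> R).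

Definition sign_vec pi (k : 'I_K) : 'cV[R]_N := \col_i (2 * pi i k - 1).

Definition lift_assignment pi : relax_var N K :=
  (sign_vec pi, fun k => sign_vec pi k *m (sign_vec pi k)^T).

Definition prod_assignment pi : milp_var N K :=
  (pi, fun i j k => pi i k * pi j k).

Lemma milp_feasible_prod n pi eta :
  milp_feasible n (pi, eta) -> milp_feasible n (prod_assignment pi).
Proof.
move=> [pi01 _ sum_i sum_k _]; split=> // i j k;
  by case: (pi01 i k) => ->; case: (pi01 j k) => ->; lra.
Qed.

(** Termwise: the product is 1 only if both factors are 1, and then the linking constraint forces
    [eta >= 1]; otherwise it is 0 and [eta >= 0] suffices. *)
Lemma milp_obj_prod_le D n pi eta :
  (forall i j, 0 <= D i j) -> milp_feasible n (pi, eta) ->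
  milp_obj D n (prod_assignment pi) <= milp_obj D n (pi, eta).
Proof.
move=> D0 [pi01 eta0 _ _ eta1]; rewrite ler_wpM2l ?invr_ge0 ?ler0n//.
apply: ler_sum => k _; rewrite ler_wpM2l ?invr_ge0 ?ler0n//.
apply: ler_sum => i _; apply: ler_sum => j _ /=; rewrite ler_wpM2l//.
move: (eta0 i j k) (eta1 i j k).
by case: (pi01 i k) => ->; case: (pi01 j k) => ->; lra.
Qed.

(** The elementwise expressions factor as [(1+x_i)(1+x_j)], [(1-x_i)(1-x_j)], [(x_i-1)(x_j+1)] and
    [(x_i+1)(x_j-1)], so entries 1 and -1 give the required signs. *)
Lemma sdp_feasible_lift n pi eta :
  milp_feasible n (pi, eta) ->
  relax_feasible (@C_SDP R N) n (lift_assignment pi).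
Proof.
move=> [pi01 _ sum_i sum_k _]; split=> [k|]; last first.
  (* Each point has total weight 1 over the clusters, so coordinate [i] sums to [2 * 1 - K]. *)
  apply/colP => i; rewrite summxE !mxE mulr1.
  under eq_bigr do rewrite mxE.
  rewrite big_split /= -mulr_sumr sum_k sumr_const card_ord.
  by rewrite mulr1 mulNrn.
pose x := sign_vec pi k.
have ones_x : (ones N)^T *m x = (card_offset N (n k))%:M.
  apply/matrixP => i j; rewrite !ord1 !mxE eqxx mulr1n.
  under eq_bigr do rewrite !mxE mul1r.
  by rewrite big_split /= -mulr_sumr sum_i sumr_const card_ord mulNrn.
have x_sqr i : x i 0 * x i 0 = 1.
  by rewrite mxE; case: (pi01 i k) => ->; ring.
split.
- split=> /=.
  + by rewrite trmx_mul trmxK.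
  + by rewrite ones_x mxE eqxx mulr1n.
  (* Here [M 1 = x (x^T 1)], and [x^T 1] is the transpose of the scalar in [ones_x]. *)
  + rewrite -mulmxA -[X in _ *m X]trmxK trmx_mul trmxK ones_x.
    by rewrite tr_scalar_mx mul_mx_scalar.
  + by apply/colP => i; rewrite !mxE big_ord1 !mxE -[RHS](x_sqr i) mxE.
- rewrite /loewner_ge subrr; split; first by rewrite trmx0.
  by move=> v; rewrite mulmx0 mul0mx mxE.
- split=> i j; rewrite !mxE !big_ord1 !mxE;
  by case: (pi01 i k) => ->; case: (pi01 j k) => ->; lra.
Qed.

(** Entrywise [x_i x_j + 1 + x_i + x_j = (1 + x_i)(1 + x_j) = 4 pi_i pi_j], which turns the factor
    1/8 into 1/2. *)
Lemma relax_obj_lift D n pi :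
  relax_obj D n (lift_assignment pi) = milp_obj D n (prod_assignment pi).
Proof.
rewrite /relax_obj /milp_obj /inner_mx mulmx_sumr raddf_sum /= !mulr_sumr.
apply: eq_bigr => k _; rewrite -scalemxAr linearZ /=.
rewrite mulrCA [RHS]mulrCA; congr (_ * _).
rewrite /mxtrace !mulr_sumr; apply: eq_bigr => i _.
rewrite mxE !mulr_sumr; apply: eq_bigr => j _.
rewrite !mxE !big_ord1 !mxE.
by field.
Qed.

Lemma milp_has_min D n :
  (forall i j, 0 <= D i j) -> milp_feasible (R := R) (N := N) n !=set0 ->
  exists v, is_min (milp_values D n) v.
Proof.
move=> D0 [[pi0 eta0] F0].
(* Boolean tables form a finite type, so a best feasible one exists; a feasible [pi] is recovered
   from the table of its entries equal to 1. *)
pose assign (b : {ffun 'I_N * 'I_K -> bool}) :=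
  prod_assignment (fun i k => (b (i, k))%:R : R).
have assignE pi eta : milp_feasible n (pi, eta) ->
    prod_assignment pi = assign [ffun ik => pi ik.1 ik.2 == 1].
  move=> [pi01 _ _ _ _].
  rewrite /assign; congr prod_assignment; apply/funext => i; apply/funext => k.
  rewrite ffunE /=.
  by case: (pi01 i k) => ->; rewrite ?eqxx// eq_sym oner_eq0.
pose feas b := `[< milp_feasible n (assign b) >].
have feasP pi eta : milp_feasible n (pi, eta) ->
    feas [ffun ik => pi ik.1 ik.2 == 1].
  move=> F; apply/asboolP; rewrite -(assignE _ _ F).
  exact: milp_feasible_prod F.
case: (arg_minP (fun b => milp_obj D n (assign b)) (feasP _ _ F0)).
move=> b /asboolP Fb bmin; exists (milp_obj D n (assign b)); split.
  by exists (assign b).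
move=> _ [[pi eta] F <-]; apply: le_trans (milp_obj_prod_le D n _ _ D0 F).
by rewrite (assignE _ _ F); apply: bmin; exact: feasP F.
Qed.

(** The points are cut into blocks of sizes [n k], each block being one cluster. *)
Lemma milp_feasible_nonempty n :
  (\sum_(k < K) n k)%N = N -> milp_feasible (R := R) (N := N) n !=set0.
Proof.
move=> sum_n.
(* [tagnat] identifies an index below the sum of the [n k] with a pair (block, position); [sig1]
   reads off the block. *)
pose cluster (i : 'I_N) : 'I_K := tagnat.sig1 (cast_ord (esym sum_n) i).
exists (prod_assignment (fun i k => (cluster i == k)%:R)).
split=> [i k|i j k|k|i|i j k].
- by case: eqP; [right | left].
- by rewrite -natrM ler0n.
- rewrite -natr_sum; congr _%:R.
  rewrite (reindex (cast_ord sum_n)) /=; last first.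
    apply: onW_bij; exists (cast_ord (esym sum_n)).
      exact: cast_ordK.
    exact: cast_ordKV.
  under eq_bigr do rewrite /cluster cast_ordK.
  rewrite (reindex _ tagnat.rank_bij_on) /=.
  under eq_bigr do rewrite /tagnat.sig1 tagnat.rankK.
  (* After reindexing by pairs, only block [k] contributes, with [n k] ones. *)
  transitivity (\sum_(l < K) \sum_(j < n l) (l == k))%N.
    by rewrite sig_big_dep.
  under eq_bigr do rewrite sum_nat_const card_ord.
  rewrite (bigD1 k) //= eqxx muln1 big1 ?addn0// => l /negbTE ->.
  by rewrite muln0.
- rewrite (bigD1 (cluster i)) //= eqxx big1 ?addr0// => k.
  by rewrite eq_sym => /negbTE ->.
- by case: eqP => _; case: eqP => _ /=; lra.
Qed.

End Lifting.

Theorem theorem2 (R : realType) (N K d : nat) (xi : 'I_N -> 'cV[R]_d)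
    (n : 'I_K -> nat)
    (n_gt0 : forall k, (0 < n k)%N)
    (sum_n : (\sum_(k < K) n k)%N = N) :
  exists vLP vSDP vP : R,
    [/\ is_min (lp_values (dist_mx xi) n) vLP,
        is_min (sdp_values (dist_mx xi) n) vSDP,
        is_min (milp_values (dist_mx xi) n) vP
      & vLP <= vSDP <= vP].
Proof.
set D := dist_mx xi.
have D0 i j : 0 <= D i j by rewrite mxE sqr_ge0.
have SDP_LP m (p : 'cV[R]_N * 'M[R]_N) : C_SDP m p -> C_LP m p.
  by move: p => [x M] [].
have feasible_SDP_LP p :
    relax_feasible (@C_SDP R N) n p -> relax_feasible (@C_LP R N) n p.
  by move: p => [x M] [Cx sx]; split=> // k; exact: SDP_LP.
(* This one assignment makes all three feasible sets nonempty. *)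
have [[pi eta] F0] := milp_feasible_nonempty (R := R) n sum_n.
have S0 := sdp_feasible_lift _ _ _ F0.
have [vLP minLP] : exists v, is_min (lp_values D n) v.
  apply: relax_has_min => //.
    by move=> m x M cx cM; exact: closed_C_LP.
  by exists (lift_assignment pi); exact: feasible_SDP_LP.
have [vSDP minSDP] : exists v, is_min (sdp_values D n) v.
  apply: relax_has_min => //; last by exists (lift_assignment pi).
  by move=> m x M cx cM; exact: closed_C_SDP.
have [vP minP] := milp_has_min D n D0 (ex_intro _ _ F0).
exists vLP, vSDP, vP; split=> //; apply/andP; split.
  (* The semidefinite minimizer is feasible for the linear program, with the same objective. *)
  case: minSDP => -[p Fp <-] _; apply: minLP.2.
  by exists p => //; exact: feasible_SDP_LP.
(* Passing to the product form does not raise the value, and the lift attains that value in the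
   semidefinite program. *)
case: minP => -[[rho theta] F <-] _.
apply: le_trans (milp_obj_prod_le D n _ _ D0 F).
rewrite -relax_obj_lift; apply: minSDP.2.
by exists (lift_assignment rho) => //; exact: sdp_feasible_lift F.
Qed.
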